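(* For every $n\in\mathbb{N}$ (positive integer), the Fibonacci cube $\Gamma_n$ is interval colorable and $w(\Gamma_n)=n$. Moreover, $w(\Gamma_n)=W(\Gamma_n)=n$ for $n=1,2$, and if $n\geq 3$, then $W(\Gamma_n)\geq n+1$.
   Context: All graphs are finite, undirected, without loops or multiple edges. An interval $t$-coloring of a graph $G$ ($t$ a positive integer) is a proper edge-coloring of $G$ with colors $1,\ldots,t$ such that all colors are used and, for each vertex $v$, the set of colors of the edges incident to $v$ is an interval of integers. $G$ is interval colorable if it has an interval $t$-coloring for some positive integer $t$; then $w(G)$ and $W(G)$ denote the minimum and maximum such $t$, respectively. The Fibonacci cube $\Gamma_n$ is the graph whose vertices are the binary strings $b_1b_2\ldots b_n\in\{0,1\}^n$ with $b_i\cdot b_{i+1}=0$ for $1\le i\le n-1$ (no two consecutive 1s), two vertices being adjacent iff they differ in exactly one coordinate. *)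

(* Defs.v *)
From mathcomp Require Import all_boot.

Set Implicit Arguments.
Unset Strict Implicit.
Unset Printing Implicit Defensive.

Record sgraph := SGraph {
  svertex :> finType;
  adj : rel svertex;
  adj_sym : symmetric adj;
  adj_irr : irreflexive adj
}.

Definition edges (G : sgraph) : {set {set G}} :=
  [set [set p.1; p.2] | p : G * G & adj p.1 p.2].

Section IntervalColoring.

Variables (G : sgraph) (t : nat).

(* Colors are 1, ..., t, seen inside 'I_t.+1 = {0, ..., t}; color 0 is excluded
   on edges by [interval_coloring].  The values of c on sets of vertices that
   are not edges are irrelevant. *)
Implicit Type c : {ffun {set G} -> 'I_t.+1}.

Definition proper_coloring c : bool :=
  [forall e in edges G, forall f in edges G,
     (e != f) && (e :&: f != set0) ==> (c e != c f)].

Definition spectrum c (v : G) : {set 'I_t.+1} :=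
  [set c e | e in edges G & v \in e].

Definition is_interval (S : {set 'I_t.+1}) : bool :=
  [forall i in S, forall k in S, forall j : 'I_t.+1,
     (i <= j <= k) ==> (j \in S)].

Definition interval_coloring c : bool :=
  [&& [forall e in edges G, 0 < c e],
      proper_coloring c,
      [forall i : 'I_t.+1, (0 < i) ==> [exists e in edges G, c e == i]] &
      [forall v : G, is_interval (spectrum c v)]].

Definition interval_t_colorable : bool :=
  (0 < t) && [exists c, interval_coloring c].

End IntervalColoring.

Definition interval_colorable (G : sgraph) : Prop :=
  exists t, interval_t_colorable G t.

(* Needed for the maximum in [W] to exist. *)
Lemma interval_t_colorable_bound (G : sgraph) (t : nat) :
  interval_t_colorable G t -> t <= #|edges G|.
Proof.
case/andP=> _ /existsP[c /and4P[_ _ /forallP used _]].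
have sub : [set lift ord0 i | i : 'I_t] \subset [set c e | e in edges G].
  apply/subsetP=> _ /imsetP[i _ ->].
  have /existsP[e /andP[eE /eqP <-]] := implyP (used (lift ord0 i)) isT.
  exact: imset_f.
have := leq_trans (subset_leq_card sub) (leq_imset_card _ _).
by rewrite card_imset ?card_ord //; apply: lift_inj.
Qed.

Definition w (G : sgraph) (colG : interval_colorable G) : nat := ex_minn colG.

Definition W (G : sgraph) (colG : interval_colorable G) : nat :=
  ex_maxn colG (@interval_t_colorable_bound G).

Definition fib_string (n : nat) (b : n.-tuple bool) : bool :=
  [forall i : 'I_n.-1, ~~ (nth false b i && nth false b i.+1)].

Definition fib_vertex (n : nat) := {b : n.-tuple bool | fib_string b}.

Definition fib_adj (n : nat) (x y : fib_vertex n) : bool :=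
  #|[set i : 'I_n | tnth (val x) i != tnth (val y) i]| == 1.

Lemma fib_adj_sym (n : nat) : symmetric (@fib_adj n).
Proof.
move=> x y; rewrite /fib_adj; congr (_ == _); apply: eq_card => i.
by rewrite !inE eq_sym.
Qed.

Lemma fib_adj_irr (n : nat) : irreflexive (@fib_adj n).
Proof.
move=> x; rewrite /fib_adj (_ : [set _ | _] = set0) ?cards0 //.
by apply/setP=> i; rewrite !inE eqxx.
Qed.

Definition fibonacci_cube (n : nat) : sgraph :=
  SGraph (@fib_adj_sym n) (@fib_adj_irr n).

(* Main.v *)
Require Import Defs.
From mathcomp Require Import all_boot.
From mathcomp Require Import zify.

(** An edge of the Fibonacci cube flips one bit; position [i] can be flipped at
    the string [b] exactly when both neighbouring bits of [b] are 0 (call [i]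
    free).  Flipping position [i] changes the freeness of [i - 1] and [i + 1]
    only, and these have the other parity.  Hence, for a fixed parity, the set
    of free positions of that parity is constant along the edges flipping a
    position of that parity, so the rank of a position in that set is a
    well-defined label of the edge.

    Counting positions from 0, let K be the number of odd positions, that is,
    n / 2 rounded down.
    Give the edge at [b] flipping [i] the color K + (rank of [i] among the free
    even positions) for even [i], and K + 1 - (rank of [i] among the free odd
    positions) for odd [i].  If [b] has E free even and O free odd positions,
    its spectrum is the interval from K + 1 - O to K + E, so this is an interval
    coloring; the all-zero string sees every color from 1 to n.  As that string
    has degree n, no interval coloring uses fewer colors, and w = n.

    For n >= 3 one more color is gained by replacing K with K + 1 at all strings
    whose bit 2 is 1.  The ends of an edge then disagree on its color only if the
    edge flips bit 2.  But whenever position 2 is free so is position 0, and exchanging the ranks of 0 and 2 at the strings with bit 2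
    set repairs this: the edge flipping 2 gets K + 2 from the end with bit 2
    unset (rank 2) and (K + 1) + 1 from the other end (rank 1).  The string
    whose only 1 is at position 2 has all even positions free, so it sees the
    color n + 1.  The flag [d] selects between the two colorings
    ([label], [label_flip], [label_range], [label_onto],
    [fibonacci_cube_colorable]).

    For n <= 2 every edge contains the all-zero string, so there are only n
    edges, and at most n colors can be used. *)

Set Implicit Arguments.
Unset Strict Implicit.
Unset Printing Implicit Defensive.

(** * Interval colorings given by edge labels *)

Lemma adj_edge (G : sgraph) (x y : G) : adj x y -> [set x; y] \in edges G.
Proof.
by move=> xy; rewrite /edges; apply/imsetP; exists (x, y); rewrite ?inE.
Qed.

Lemma edgeP (G : sgraph) (e : {set G}) :
  e \in edges G -> exists x y, adj x y /\ e = [set x; y].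
Proof. by rewrite /edges => /imsetP[[x y]]; rewrite inE /= => xy ->; exists x, y. Qed.

Lemma adj_neq (G : sgraph) (x y : G) : adj x y -> x != y.
Proof. by apply: contraTneq => ->; rewrite adj_irr. Qed.

Lemma edge_at (G : sgraph) (e : {set G}) (x : G) :
  e \in edges G -> x \in e -> exists2 y, adj x y & e = [set x; y].
Proof.
case/edgeP=> [u [v [uv ->]]]; rewrite !inE => /orP[] /eqP->; first by exists v.
by exists u; rewrite 1?setUC // adj_sym.
Qed.

Lemma set2_inj (T : finType) (x y z : T) :
  x != y -> [set x; y] = [set x; z] -> y = z.
Proof.
move=> xy /setP/(_ y); rewrite !inE eqxx orbT => /esym/orP[/eqP yx|/eqP //].
by rewrite yx eqxx in xy.
Qed.

(** Replaces colors of two-element sets by labels of ordered pairs of adjacent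
    vertices, which is how the colorings below are described: each vertex
    labels its own incident edges, and the two ends have to agree. *)
Lemma colorable_of_labels (G : sgraph) (t : nat) (k : G -> G -> nat) :
    0 < t ->
    (forall x y, adj x y -> k x y = k y x) ->
    (forall x y z, adj x y -> adj x z -> k x y = k x z -> y = z) ->
    (forall x y, adj x y -> 0 < k x y <= t) ->
    (forall i, 0 < i <= t -> exists x y, adj x y /\ k x y = i) ->
    (forall x y z j, adj x y -> adj x z -> k x y <= j <= k x z ->
       exists2 u, adj x u & k x u = j) ->
  interval_t_colorable G t.
Proof.
move=> t_gt0 k_sym k_inj k_range k_onto k_interval.
rewrite /interval_t_colorable t_gt0 /=.
(* Any ordered pair spanning [e] will do, as [k] is symmetric. *)
pose c : {ffun {set G} -> 'I_t.+1} := [ffun e : {set G} =>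
  if [pick p : G * G | adj p.1 p.2 && (e == [set p.1; p.2])] is Some p
  then inord (k p.1 p.2) else ord0].
have cE x y : adj x y -> c [set x; y] = k x y :> nat.
  move=> xy; rewrite ffunE; case: pickP => [[u v]|/(_ (x, y))] /=; last first.
    by rewrite xy eqxx.
  case/andP=> uv /eqP xyuv; rewrite inordK; last first.
    by have /andP[_] := k_range _ _ uv; rewrite ltnS.
  have : u \in [set x; y] by rewrite xyuv !inE eqxx.
  rewrite !inE => /orP[] /eqP ux; rewrite ux in uv xyuv *.
    by rewrite (set2_inj (adj_neq xy) xyuv).
  rewrite setUC in xyuv; rewrite adj_sym in xy.
  by rewrite -(set2_inj (adj_neq xy) xyuv) k_sym.
apply/existsP; exists c; apply/and4P; split.
- apply/forall_inP=> e /edgeP[x [y [xy ->]]]; rewrite cE //.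
  by case/andP: (k_range _ _ xy).
- apply/forall_inP=> e eE; apply/forall_inP=> f fE.
  apply/implyP=> /andP[ef /set0Pn[x]]; rewrite inE => /andP[xe xf].
  have [y xy e_def] := edge_at eE xe; have [z xz f_def] := edge_at fE xf.
  apply: contraNneq ef => /(congr1 val); rewrite /= e_def f_def !cE //.
  by move/(k_inj _ _ _ xy xz) ->.
- apply/forallP=> i; apply/implyP=> i_gt0.
  have [|x [y [xy kxy]]] := k_onto i; first by rewrite i_gt0 -ltnS ltn_ord.
  apply/existsP; exists [set x; y]; rewrite adj_edge //=.
  by apply/eqP/val_inj; rewrite /= cE.
apply/forallP=> x; apply/forall_inP=> i iS; apply/forall_inP=> l lS.
apply/forallP=> j; apply/implyP=> ijl.
have [e] := imsetP iS; rewrite inE => /andP[eE xe] i_def.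
have [f] := imsetP lS; rewrite inE => /andP[fE xf] l_def.
have [y xy e_def] := edge_at eE xe; have [z xz f_def] := edge_at fE xf.
move: ijl; rewrite i_def l_def e_def f_def !cE // => ijl.
have [u xu kxu] := k_interval _ _ _ _ xy xz ijl.
apply/imsetP; exists [set x; u]; first by rewrite inE adj_edge //= !inE eqxx.
by apply: val_inj; rewrite /= cE.
Qed.

(** The edges at one vertex have pairwise different colors. *)
Lemma degree_le_colors (G : sgraph) (t : nat) (x : G) :
  interval_t_colorable G t -> #|[set y | adj x y]| <= t.
Proof.
case/andP=> _ /existsP[c /and4P[/forall_inP c_gt0 c_proper _ _]].
have sub : [set c [set x; y] | y in [set y | adj x y]] \subset [set~ ord0].
  apply/subsetP=> _ /imsetP[y + ->]; rewrite !inE => /adj_edge/c_gt0.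
  by rewrite lt0n.
have := subset_leq_card sub; rewrite cardsC1 card_ord card_in_imset //.
move=> y z; rewrite !inE => xy xz cyz; apply/eqP; apply: contraTT isT => yz.
have/forall_inP/(_ _ (adj_edge xy)) := c_proper.
move=> /forall_inP/(_ _ (adj_edge xz)); rewrite cyz eqxx implybF => /negP[].
apply/andP; split.
  by apply: contra yz => /eqP/(set2_inj (adj_neq xy)) ->.
by apply/set0Pn; exists x; rewrite !inE eqxx.
Qed.

(** * Ranks in a subset of the natural numbers *)

(** An element of [p] counts itself, so that ranks in [p] start at 1. *)
Definition rank (p : pred nat) (i : nat) : nat := count p (iota 0 i.+1).

Lemma rankS (p : pred nat) (i : nat) : rank p i.+1 = rank p i + p i.+1.
Proof. by rewrite /rank -[i.+2]addn1 iotaD count_cat /= addn0 add0n. Qed.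

Lemma leq_rank (p : pred nat) (i j : nat) : i <= j -> rank p i <= rank p j.
Proof.
elim: j => [|j IHj]; first by case: i.
by rewrite leq_eqVlt => /predU1P[->//|/IHj]; rewrite rankS; lia.
Qed.

Lemma rank_gt0 (p : pred nat) (i : nat) : p i -> 0 < rank p i.
Proof. by case: i => [|i] pi; rewrite ?rankS /rank /= pi ?addn1. Qed.

Lemma rank_inj (p : pred nat) (i j : nat) :
  p i -> p j -> rank p i = rank p j -> i = j.
Proof.
have lt_rank l m : p m -> l < m -> rank p l < rank p m.
  case: m => // m pm; rewrite ltnS => /(leq_rank p); rewrite rankS pm; lia.
move=> pi pj rij; case: (ltngtP i j) => // [/(lt_rank _ _ pj)|/(lt_rank _ _ pi)];
  by rewrite rij ltnn.
Qed.

(** A discrete intermediate value argument: the rank starts at 0 or 1 and grows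
    by at most 1, and it grows only at elements of [p]. *)
Lemma rank_onto (p : pred nat) (m r : nat) :
  0 < r <= rank p m -> exists2 j, p j & rank p j = r.
Proof.
elim: m => [|m IHm] r_range.
  by exists 0; move: r_range; rewrite /rank /=; case: (p 0); lia.
have [pm|pm] := boolP (p m.+1); last first.
  by apply: IHm; move: r_range; rewrite rankS (negPf pm) addn0.
have [->|r_neq] := eqVneq r (rank p m.+1); first by exists m.+1.
by apply: IHm; move: r_range r_neq; rewrite rankS pm; lia.
Qed.

Lemma count_parity (o : bool) m :
  count (fun j => odd j == o) (iota 0 m) = if o then m./2 else uphalf m.
Proof.
elim: m => [|m IHm]; first by case: o.
rewrite -addn1 iotaD count_cat IHm /= add0n addn0 addn1.
by have := odd_double_half m; rewrite uphalfE; case: o {IHm}; case: (odd m) => /=; lia.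
Qed.

(** * Labels on the free positions of a binary sequence *)

Section Labels.

Variables (n : nat) (d : bool).
Hypotheses (n_gt0 : 0 < n) (d_n : d -> 2 < n).
Implicit Type b : nat -> bool.

Definition fibonacci b : Prop := forall j, ~~ (b j && b j.+1).

(** If position [i] of a Fibonacci string carries a 1, its neighbours are 0;
    otherwise they have to be 0 for a 1 to be allowed at [i].  So [free] does not
    mention the bit at [i] itself. *)
Definition free b (i : nat) : bool :=
  [&& i < n, ~~ b i.+1 & ~~ ((0 < i) && b i.-1)].

Definition free_of_parity (o : bool) b : pred nat :=
  fun j => (odd j == o) && free b j.

Definition frees (o : bool) b : nat := rank (free_of_parity o b) n.-1.

Definition shifted b : bool := d && b 2.

(** The color that separates the two parities at [b]: even positions get colors
    above the pivot, odd ones get the pivot and colors below it. *)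
Definition pivot b : nat := n./2 + shifted b.

(** Exchanging the ranks of 0 and 2 at shifted strings keeps the color of the
    edges that flip bit 2: the rank of 2 falls from 2 to 1 when the pivot
    rises by 1. *)
Definition swap02 b (i : nat) : nat :=
  if shifted b then if i == 0 then 2 else if i == 2 then 0 else i else i.

Definition label b (i : nat) : nat :=
  if odd i then (pivot b).+1 - rank (free_of_parity true b) i
  else pivot b + rank (free_of_parity false b) (swap02 b i).

Lemma odd_swap02 b i : odd (swap02 b i) = odd i.
Proof. by rewrite /swap02; case: shifted; case: i => [|[|[]]]. Qed.

Lemma swap02K b : involutive (swap02 b).
Proof.
by move=> i; rewrite /swap02; case: shifted => //; case: i => [|[|[]]].
Qed.

(** At a shifted string the bit 2 is 1, so the bits 1 and 3 are 0 and both 0 and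
    2 are free. *)
Lemma free_swap02 b i : fibonacci b -> free b i -> free b (swap02 b i).
Proof.
move=> b_fib; rewrite /swap02; case: ifP => // /andP[/d_n n_gt2 b2].
have := b_fib 1; have := b_fib 2; rewrite b2 andbT /= => b3 b1.
have [_ _|_] := eqVneq i 0; first by rewrite /free n_gt2 b3.
by have [_ _|//] := eqVneq i 2; rewrite /free n_gt0 b1.
Qed.

Lemma frees_count (o : bool) b : frees o b = count (free_of_parity o b) (iota 0 n).
Proof. by rewrite /frees /rank prednK. Qed.

Lemma frees_le (o : bool) b : frees o b <= if o then n./2 else uphalf n.
Proof.
rewrite frees_count -count_parity; apply: sub_count => j.
by case/andP.
Qed.

Lemma frees_full (o : bool) b :
    (forall j, j < n -> odd j = o -> free b j) ->
  frees o b = if o then n./2 else uphalf n.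
Proof.
move=> full; rewrite frees_count -count_parity; apply: eq_in_count => j.
rewrite mem_iota add0n => /andP[_ j_lt]; rewrite /free_of_parity.
by have [/(full _ j_lt)->|] := eqVneq (odd j) o.
Qed.

Lemma rank_le_frees (o : bool) b i : i < n -> rank (free_of_parity o b) i <= frees o b.
Proof. by move=> i_lt; apply: leq_rank; rewrite -ltnS prednK. Qed.

Lemma rank_odd_le_pivot b i : i < n -> rank (free_of_parity true b) i <= pivot b.
Proof.
move=> /(rank_le_frees true b)/leq_trans-> //.
by rewrite (leq_trans (frees_le _ _)) // leq_addr.
Qed.

(** With [label_onto], this identifies the spectrum at [b] as an interval: the
    even free positions fill the colors right above the pivot, the odd ones fill
    those ending at the pivot. *)
Lemma label_range b i : fibonacci b -> free b i ->
  pivot b < label b i + frees true b /\ label b i <= pivot b + frees false b.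
Proof.
move=> b_fib free_i; have /and3P[i_lt _ _] := free_i.
rewrite /label; case: ifPn => i_odd.
  have := rank_le_frees true b i_lt; have := rank_odd_le_pivot b i_lt.
  have : 0 < rank (free_of_parity true b) i.
    by apply: rank_gt0; rewrite /free_of_parity i_odd.
  lia.
have free_si := free_swap02 b_fib free_i; have /and3P[si_lt _ _] := free_si.
have := rank_le_frees false b si_lt.
have : 0 < rank (free_of_parity false b) (swap02 b i).
  by apply: rank_gt0; rewrite /free_of_parity odd_swap02 (negPf i_odd).
lia.
Qed.

Lemma label_gt_pivot b i : fibonacci b -> free b i -> (pivot b < label b i) = ~~ odd i.
Proof.
move=> b_fib free_i; rewrite /label; case: ifPn => i_odd /=.
  have : 0 < rank (free_of_parity true b) i.
    by apply: rank_gt0; rewrite /free_of_parity i_odd.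
  lia.
have : 0 < rank (free_of_parity false b) (swap02 b i); last by lia.
apply: rank_gt0; rewrite /free_of_parity odd_swap02 (negPf i_odd) /=.
exact: free_swap02.
Qed.

(** The pivot separates the two parities, and ranks are injective within each. *)
Lemma label_inj b i j : fibonacci b -> free b i -> free b j ->
  label b i = label b j -> i = j.
Proof.
move=> b_fib free_i free_j eq_lab.
have := label_gt_pivot b_fib free_i; rewrite eq_lab label_gt_pivot //.
move/negb_inj/esym => eq_odd; move: eq_lab; rewrite /label eq_odd.
have /and3P[i_lt _ _] := free_i; have /and3P[j_lt _ _] := free_j.
case: ifPn => j_odd.
  have := rank_odd_le_pivot b i_lt; have := rank_odd_le_pivot b j_lt.
  move=> le_j le_i eq_lab.
  have eq_rank : rank (free_of_parity true b) i = rank (free_of_parity true b) j by lia.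
  by apply: rank_inj eq_rank; rewrite /free_of_parity ?eq_odd j_odd.
move/addnI => eq_rank; apply: (can_inj (swap02K b)); apply: rank_inj eq_rank.
  by rewrite /free_of_parity odd_swap02 eq_odd (negPf j_odd) free_swap02.
by rewrite /free_of_parity odd_swap02 (negPf j_odd) free_swap02.
Qed.

Lemma label_onto b l : fibonacci b ->
    pivot b < l + frees true b -> l <= pivot b + frees false b ->
  exists2 i, free b i & label b i = l.
Proof.
move=> b_fib lo hi; have [le_l|lt_l] := leqP l (pivot b).
  have [|i /andP[/eqP i_odd free_i] rank_i] :=
      @rank_onto (free_of_parity true b) n.-1 ((pivot b).+1 - l).
    by rewrite -/(frees true b); lia.
  by exists i => //; rewrite /label i_odd rank_i; lia.
have [|i /andP[/eqP i_even free_i] rank_i] :=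
    @rank_onto (free_of_parity false b) n.-1 (l - pivot b).
  by rewrite -/(frees false b); lia.
exists (swap02 b i); first exact: free_swap02.
by rewrite /label odd_swap02 i_even swap02K rank_i; lia.
Qed.

(** The value does not depend on the bit 2: at an unshifted string 2 has rank 2,
    after 0, which is free because the bit 1 is 0; at a shifted string 2 takes
    the rank 1 of 0, and the pivot is larger by 1. *)
Lemma label2 b : d -> fibonacci b -> free b 2 -> label b 2 = n./2 + 2.
Proof.
move=> d_true b_fib free2; have /and3P[_ _ b1] := free2.
have free0 : free b 0 by rewrite /free n_gt0; move: b1 => /= ->.
rewrite /label /pivot /swap02 /shifted d_true /=.
case: (b 2); rewrite /rank /= /free_of_parity /= free0 ?free2 /=; lia.
Qed.

(** Freeness of the positions with the parity of [i] depends only on bits of the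
    other parity, which the flip leaves alone; so the rank of [i] is the same at
    both ends.  The pivot changes only when the flip is at 2, which is covered
    by [label2]. *)
Lemma label_flip b b' i : fibonacci b -> fibonacci b' -> free b i ->
  (forall j, j != i -> b j = b' j) -> label b i = label b' i.
Proof.
move=> b_fib b'_fib free_i eq_bb'.
have eq_free j : odd j = odd i -> free b j = free b' j.
  move=> eq_odd; rewrite /free; congr [&& _, ~~ _ & ~~ _].
    by apply: eq_bb'; apply/eqP; lia.
  by case: j eq_odd => //= j eq_odd; apply: eq_bb'; apply/eqP; lia.
have eq_rank j : rank (free_of_parity (odd i) b) j = rank (free_of_parity (odd i) b') j.
  apply: eq_count => k; rewrite /free_of_parity.
  by have [/eq_free|] := eqVneq (odd k) (odd i).
have [/andP[d_true /eqP i2]|] := boolP (d && (i == 2)).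
  by subst i; rewrite !label2 // -eq_free.
move=> not_d2; have eq_shifted : shifted b = shifted b'.
  rewrite /shifted; move: not_d2; case: (d) => //= i_neq2.
  by rewrite eq_bb' // eq_sym.
rewrite /label /pivot /swap02 eq_shifted.
by move: eq_rank; case: (odd i) => ->.
Qed.

End Labels.

(** * Fibonacci strings as binary sequences *)

Section FibonacciCube.

Variable n : nat.
Implicit Types x y z : fib_vertex n.

Definition bit x (j : nat) : bool := nth false (val x) j.

Lemma bit_out x j : n <= j -> bit x j = false.
Proof. by move=> n_le; rewrite /bit nth_default // size_tuple. Qed.

Lemma tnth_bit x (i : 'I_n) : tnth (val x) i = bit x i.
Proof. exact: tnth_nth. Qed.

Lemma bit_fibonacci x : fibonacci (bit x).
Proof.
move=> j; have [j_lt|n_le] := ltnP j n.-1; last first.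
  by rewrite (@bit_out x j.+1) ?andbF; lia.
by have /forallP/(_ (Ordinal j_lt)) := valP x.
Qed.

Lemma bit_inj x y : bit x =1 bit y -> x = y.
Proof. by move=> eq_xy; apply/val_inj/eq_from_tnth => i; rewrite !tnth_bit. Qed.

Lemma vertex_of_bits (f : nat -> bool) :
  fibonacci f -> exists x, forall j, j < n -> bit x j = f j.
Proof.
move=> f_fib; pose b := [tuple f i | i < n].
have nth_b j : j < n -> nth false b j = f j.
  by move=> j_lt; rewrite -[j]/(val (Ordinal j_lt)) -tnth_nth tnth_mktuple.
have b_fib : fib_string b.
  by apply/forallP=> i; have i_lt := ltn_ord i; rewrite !nth_b //; lia.
by exists (Sub b b_fib); apply: nth_b.
Qed.

Lemma fib_adjP x y : reflect
  (exists2 i, i < n /\ bit x i != bit y i & forall j, j != i -> bit x j = bit y j)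
  (fib_adj x y).
Proof.
apply: (iffP cards1P) => [[i diff_i]|[i [i_lt diff_i] eq_xy]].
  exists (val i) => [|j j_neq].
    split; first exact: ltn_ord.
    by move/setP/(_ i): diff_i; rewrite !inE eqxx !tnth_bit => ->.
  have [j_lt|n_le] := ltnP j n; last by rewrite !bit_out.
  move/setP/(_ (Ordinal j_lt)): diff_i; rewrite !inE !tnth_bit -val_eqE /=.
  by rewrite (negPf j_neq) => /negbFE/eqP.
exists (Ordinal i_lt); apply/setP=> j; rewrite !inE !tnth_bit -val_eqE /=.
by have [->|/eq_xy->] := eqVneq (val j) i; rewrite ?eqxx.
Qed.

Definition flipped x y : nat := find (fun j => bit x j != bit y j) (iota 0 n).

Lemma flippedC x y : flipped x y = flipped y x.
Proof. by apply: eq_find => j; rewrite eq_sym. Qed.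

Lemma flipped_eq x y i : i < n -> bit x i != bit y i ->
  (forall j, j != i -> bit x j = bit y j) -> flipped x y = i.
Proof.
move=> i_lt diff_i eq_xy.
have has_diff : has (fun j => bit x j != bit y j) (iota 0 n).
  by apply/hasP; exists i; rewrite ?mem_iota.
have := nth_find 0 has_diff; rewrite nth_iota -?/(flipped x y); last first.
  by rewrite -[X in _ < X](size_iota 0) -has_find.
by apply: contraNeq => /eq_xy ->.
Qed.

(** Both neighbouring bits of the flipped position are 0, since one of the two
    ends has a 1 there. *)
Lemma adj_flipped x y : fib_adj x y ->
  [/\ free n (bit x) (flipped x y), bit x (flipped x y) != bit y (flipped x y)
    & forall j, j != flipped x y -> bit x j = bit y j].
Proof.
case/fib_adjP=> i [i_lt diff_i] eq_xy; rewrite (flipped_eq i_lt diff_i eq_xy).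
split=> //; rewrite /free i_lt /=.
have eqS := eq_xy i.+1; have eqP := eq_xy i.-1.
have fxS := bit_fibonacci x i; have fyS := bit_fibonacci y i.
have fxP := bit_fibonacci x i.-1; have fyP := bit_fibonacci y i.-1.
apply/andP; split.
  move: fxS fyS diff_i; rewrite eqS ?neq_ltn ?ltnSn ?orbT //.
  by case: (bit x i); case: (bit y i); case: (bit y i.+1).
have [->//|i_gt0] := posnP i.
move: fxP fyP diff_i; rewrite /= prednK // eqP; last by rewrite neq_ltn; lia.
by case: (bit x i); case: (bit y i); case: (bit y i.-1).
Qed.

Lemma flip_exists x i : free n (bit x) i -> exists2 y, fib_adj x y & flipped x y = i.
Proof.
case/and3P=> i_lt bitS bitP.
have [|y y_bit] := @vertex_of_bits (fun j => if j == i then ~~ bit x i else bit x j).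
  move=> j; have [ij|ji] := eqVneq j i; have [Sji|Sji] := eqVneq j.+1 i.
  - lia.
  - by rewrite ij (negPf bitS) andbF.
  - by move: bitP; rewrite -Sji /= => /negPf->.
  - exact: bit_fibonacci.
have diff_i : bit x i != bit y i by rewrite y_bit // eqxx; case: bit.
have eq_xy j : j != i -> bit x j = bit y j.
  have [j_lt /negPf ji|n_le] := ltnP j n; first by rewrite y_bit // ji.
  by rewrite !bit_out.
by exists y; [apply/fib_adjP; exists i | apply: flipped_eq].
Qed.

Lemma flipped_inj x y z :
  fib_adj x y -> fib_adj x z -> flipped x y = flipped x z -> y = z.
Proof.
move=> /adj_flipped[_ diff_y eq_y] /adj_flipped[_ diff_z eq_z] yz.
apply: bit_inj => j; have [->|j_neq] := eqVneq j (flipped x y).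
  by move: diff_y diff_z; rewrite -yz; case: bit; case: bit; case: bit.
by rewrite -eq_y // eq_z // -yz.
Qed.

(** * Interval colorings of Fibonacci cubes *)

(** The labels give a coloring with exactly the colors 1, ..., n + d: the lower
    bound K + 1 - O is at least 1 because O <= K, and all colors occur at the
    all-zero string, except n + 1, which occurs at the string whose only 1 is at
    position 2. *)
Lemma fibonacci_cube_colorable (d : bool) : 0 < n -> (d -> 2 < n) ->
  interval_t_colorable (fibonacci_cube n) (n + d).
Proof.
move=> n_gt0 d_n.
pose k x y := label n d (bit x) (flipped x y).
have pivotE x : pivot n d (bit x) = n./2 + (d && bit x 2) by [].
have n_half : uphalf n + n./2 = n by have := odd_double_half n; rewrite uphalfE; lia.
have frees1 x := frees_le n_gt0 true (bit x).
have frees0 x := frees_le n_gt0 false (bit x).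
apply: (@colorable_of_labels (fibonacci_cube n) _ k); rewrite /= ?addn_gt0 ?n_gt0 //.
- move=> x y xy; have [free_i _ eq_xy] := adj_flipped xy.
  rewrite /k (flippedC y x).
  exact: (label_flip n_gt0 d_n (bit_fibonacci x) (bit_fibonacci y) free_i eq_xy).
- move=> x y z xy xz; have [free_y _ _] := adj_flipped xy.
  have [free_z _ _] := adj_flipped xz.
  by move/(label_inj n_gt0 d_n (bit_fibonacci x) free_y free_z); apply: flipped_inj.
- move=> x y /adj_flipped[free_i _ _].
  have := label_range n_gt0 d_n (bit_fibonacci x) free_i.
  rewrite -/(k x y) pivotE; have := frees1 x; have := frees0 x.
  by case: (d) (bit x 2) => [] [] /=; lia.
- move=> l l_range.
  (* The all-zero string if [l <= n], the string with a single 1 at position 2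
     if [l = n.+1]; its even positions are free in both cases. *)
  have [|x x_bit] := @vertex_of_bits (fun j => [&& d, n < l & j == 2]).
    by move=> j; apply/negP; lia.
  have x_even j : j < n -> odd j = false -> free n (bit x) j.
    move=> j_lt j_even; rewrite /free j_lt /=.
    have odd_bit m : odd m -> bit x m = false.
      have [m_lt m_odd|/bit_out->//] := ltnP m n.
      by rewrite x_bit //; lia.
    rewrite odd_bit /= ?j_even //; case: j j_even {j_lt} => //= j.
    by move/negbFE=> j_odd; rewrite odd_bit.
  have x_free j : l <= n -> j < n -> free n (bit x) j.
    move=> l_le j_lt; rewrite /free j_lt /=.
    have zero m : bit x m = false.
      have [m_lt|/bit_out->//] := ltnP m n.
      by rewrite x_bit //; lia.
    by rewrite !zero andbF.
  have frees_even := frees_full n_gt0 x_even.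
  have [||i free_i lab_i] := @label_onto n d n_gt0 d_n (bit x) l (bit_fibonacci x).
  + have [l_le|l_gt] := leqP l n.
      rewrite (frees_full n_gt0 (fun j lt_j _ => x_free j l_le lt_j)) pivotE.
      have [n_gt2|n_le] := ltnP 2 n; last by rewrite bit_out //; lia.
      by rewrite x_bit //; lia.
    by rewrite pivotE; case: (bit x 2) (d) l_range => [] [] /=; lia.
  + rewrite frees_even pivotE.
    have [n_gt2|n_le] := ltnP 2 n; last by case: (d) d_n l_range => /=; lia.
    by rewrite x_bit //; case: (d) l_range => /=; lia.
  have [y xy y_flip] := flip_exists free_i.
  by exists x, y; rewrite /k y_flip.
move=> x y z l /adj_flipped[free_y _ _] /adj_flipped[free_z _ _] l_range.
have := label_range n_gt0 d_n (bit_fibonacci x) free_y.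
have := label_range n_gt0 d_n (bit_fibonacci x) free_z.
rewrite -/(k x y) -/(k x z) => z_range y_range.
have [||i free_i lab_i] := @label_onto n d n_gt0 d_n (bit x) l (bit_fibonacci x).
- lia.
- lia.
have [u xu u_flip] := flip_exists free_i.
by exists u; rewrite // /k u_flip.
Qed.

(** The star at the all-zero string serves both bounds: its size forces n colors,
    and for n <= 2 it contains all edges. *)
Lemma zero_star : exists x (f : 'I_n -> fib_vertex n),
  bit x =1 xpred0 /\ forall i, fib_adj x (f i) /\ flipped x (f i) = i.
Proof.
have [//|x x_bit] := @vertex_of_bits xpred0.
have x0 : bit x =1 xpred0.
  by move=> j; have [/x_bit//|/bit_out->] := ltnP j n.
have nbr (i : 'I_n) : exists y, fib_adj x y /\ flipped x y = i.
  have [|y xy y_flip] := @flip_exists x i; last by exists y.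
  by rewrite /free ltn_ord !x0 andbF.
by have [f f_flip] := fin_all_exists nbr; exists x, f.
Qed.

Lemma colors_ge_dimension t : interval_t_colorable (fibonacci_cube n) t -> n <= t.
Proof.
have [x [f [_ f_flip]]] := zero_star.
move/(@degree_le_colors (fibonacci_cube n) t x); apply: leq_trans.
rewrite -[leqLHS](card_ord n) -(card_imset _ (f := f)); last first.
  move=> i j eq_f; apply: val_inj => /=.
  by have [_ <-] := f_flip i; have [_ <-] := f_flip j; rewrite eq_f.
apply: subset_leq_card; apply/subsetP=> _ /imsetP[i _ ->].
by rewrite inE; case: (f_flip i).
Qed.

(** For n <= 2 all positions are equal or neighbours, so an end of an edge with
    a 0 at the flipped position is the all-zero string; the edges are thus the n
    edges of the star at that string. *)
Lemma colors_le_dimension t :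
  n <= 2 -> interval_t_colorable (fibonacci_cube n) t -> t <= n.
Proof.
move=> n_le2 /interval_t_colorable_bound/leq_trans-> //.
have [x [f [x0 f_flip]]] := zero_star.
have zero_end u v : fib_adj u v -> bit u (flipped u v) = false -> u = x.
  case/adj_flipped=> /and3P[i_lt uS uP] _ _ u_i.
  apply: bit_inj => j; rewrite x0; apply/negbTE.
  have [j_lt|/bit_out->//] := ltnP j n.
  set i := flipped u v in i_lt uS uP u_i.
  have [->|ji] := eqVneq j i; first by rewrite u_i.
  have [Sij|Sji] : i.+1 = j \/ (0 < i) && (j == i.-1) by lia.
    by rewrite -Sij.
  by move: uP; case/andP: Sji => -> /eqP->.
have sub : edges (fibonacci_cube n) \subset [set [set x; f i] | i : 'I_n].
  apply/subsetP=> e /edgeP[u [v [/= + ->]]].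
  wlog u_i : u v / bit u (flipped u v) = false.
    move=> wlog_uv uv; have [_ diff_uv _] := adj_flipped uv.
    case u_i: (bit u (flipped u v)); last exact: wlog_uv.
    rewrite setUC; apply: wlog_uv; last by rewrite fib_adj_sym.
    by rewrite flippedC; move: diff_uv; rewrite u_i; case: bit.
  move=> uv; have u_x := zero_end u v uv u_i; subst u.
  have [/and3P[i_lt _ _] _ _] := adj_flipped uv.
  apply/imsetP; exists (Ordinal i_lt) => //.
  have [xf f_i] := f_flip (Ordinal i_lt).
  by rewrite (flipped_inj xf uv f_i).
rewrite (leq_trans (subset_leq_card sub)) // (leq_trans (leq_imset_card _ _)) //.
by rewrite card_ord.
Qed.

End FibonacciCube.

(** * Extremal numbers of colors *)

Theorem theorem7p1 (n : nat) (n_gt0 : 0 < n) :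
  exists colG : interval_colorable (fibonacci_cube n),
    [/\ w colG = n,
        n = 1 \/ n = 2 -> w colG = W colG /\ W colG = n
      & 3 <= n -> n.+1 <= W colG].
Proof.
have col_n : interval_t_colorable (fibonacci_cube n) n.
  rewrite -[X in interval_t_colorable _ X]addn0.
  by apply: (@fibonacci_cube_colorable n false).
have colG : interval_colorable (fibonacci_cube n) by exists n.
exists colG.
have w_n : w colG = n.
  rewrite /w; case: ex_minnP => t /colors_ge_dimension n_le t_min.
  by apply/eqP; rewrite eqn_leq n_le t_min.
split=> // [n12|n_ge3].
  suff W_n : W colG = n by rewrite w_n W_n.
  rewrite /W; case: ex_maxnP => t col_t t_max.
  apply/eqP; rewrite eqn_leq t_max // andbT colors_le_dimension //.
  by case: n12 => ->.
rewrite /W; case: ex_maxnP => t _ t_max; apply: t_max.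
by rewrite -addn1; apply: (@fibonacci_cube_colorable n true).
Qed.
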